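(* Let $L$ be a finite-dimensional Lie algebra over an arbitrary field $F$. (i) If $L$ is solvable then $L\in\mathcal{MD}$. (ii) If $L$ is completely solvable, then $L\in\mathcal{MU}$ if and only if $L$ is nilpotent. (iii) If $L$ is supersolvable then $L\in\mathcal{MA}$. (iv) If $L$ is metabelian then $L\in\mathcal{MA}$; in particular, if $L$ is completely solvable and $\phi$-free then $L\in\mathcal{MA}$.
   Context: For a subalgebra $M$ of $L$, a subalgebra $U$ of $L$ is a supplement to $M$ in $L$ if $L=M+U$. A maximal subalgebra is a proper subalgebra that is maximal under inclusion among proper subalgebras. $\mathcal{MA}$ is the class of Lie algebras $L$ such that every maximal subalgebra of $L$ has an abelian supplement. $\mathcal{MD}$ is the class of Lie algebras $L$ such that every maximal subalgebra $M$ of $L$ has a supplement $U$ with $[U,U]\subseteq M$. $\mathcal{MU}$ is the class of Lie algebras $L$ such that every maximal subalgebra of $L$ has a supplement $U$ every element of which acts nilpotently on $L$ (i.e. $\mathrm{ad}_L\,u$ is nilpotent for every $u\in U$). $L$ is completely solvable if $L^2=[L,L]$ is nilpotent; supersolvable if there is a chain $0=L_0\subset L_1\subset\cdots\subset L_n=L$ of ideals of $L$ with $\dim L_i=i$; metabelian if $[L^2,L^2]=0$. The Frattini ideal $\phi(L)$ is the largest ideal of $L$ contained in all maximal subalgebras of $L$; $L$ is $\phi$-free if $\phi(L)=0$. *)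

(* Defs.v *)
From HB Require Import structures.
From mathcomp Require Import all_boot all_order all_algebra.
From mathcomp Require Import boolp.

Set Implicit Arguments.
Unset Strict Implicit.
Unset Printing Implicit Defensive.

Import GRing.Theory.
Local Open Scope ring_scope.

(* A vectType is finite-dimensional, so a lieAlgType F is a finite-dimensional
   Lie algebra over F.  The bracket is required to be alternating, not merely
   antisymmetric, because F may have characteristic 2. *)
HB.mixin Record isLieAlgebra (F : fieldType) (L : Type) of Vector F L := {
  lie_bracket : L -> L -> L;
  lie_linear_l : forall y : L, linear (fun x => lie_bracket x y);
  lie_linear_r : forall x : L, linear (lie_bracket x);
  lie_alternating : forall x : L, lie_bracket x x = 0;
  lie_jacobi : forall x y z : L,
    lie_bracket x (lie_bracket y z) + lie_bracket y (lie_bracket z x)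
      + lie_bracket z (lie_bracket x y) = 0
}.

#[short(type="lieAlgType")]
HB.structure Definition LieAlgebra (F : fieldType) :=
  { L of isLieAlgebra F L & Vector F L }.

Section LieTheory.
Variables (F : fieldType) (L : lieAlgType F).
Implicit Types (x y : L) (U V W M I J : {vspace L}).

(* [U, V]: the span of all brackets of u in U and v in V, by bilinearity spanned
   by those of basis vectors; see lie_prodP. *)
Definition lie_prod U V : {vspace L} :=
  <<[seq lie_bracket u v | u <- vbasis U, v <- vbasis V]>>%VS.

Lemma lie_sumZl (I : Type) (r : seq I) (a : I -> F) (f : I -> L) y :
  lie_bracket (\sum_(i <- r) a i *: f i) y = \sum_(i <- r) a i *: lie_bracket (f i) y.
Proof.
have lin0 : lie_bracket 0 y = 0.
  have := lie_linear_l y 1 0 0; rewrite scaler0 addr0 scale1r => e.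
  by apply: (addrI (lie_bracket 0 y)); rewrite addr0.
elim: r => [|i r IHr]; first by rewrite !big_nil.
by rewrite !big_cons lie_linear_l IHr.
Qed.

Lemma lie_sumZr (I : Type) (r : seq I) (a : I -> F) (f : I -> L) x :
  lie_bracket x (\sum_(i <- r) a i *: f i) = \sum_(i <- r) a i *: lie_bracket x (f i).
Proof.
have lin0 : lie_bracket x 0 = 0.
  have := lie_linear_r x 1 0 0; rewrite scaler0 addr0 scale1r => e.
  by apply: (addrI (lie_bracket x 0)); rewrite addr0.
elim: r => [|i r IHr]; first by rewrite !big_nil.
by rewrite !big_cons lie_linear_r IHr.
Qed.

Lemma lie_prodP U V W :
  reflect (forall x y, x \in U -> y \in V -> lie_bracket x y \in W)
          (lie_prod U V <= W)%VS.
Proof.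
apply: (iffP idP) => [sW x y xU yV | H].
  rewrite (coord_vbasis xU) (coord_vbasis yV) lie_sumZl.
  apply: memv_suml => i _; apply: memvZ; rewrite lie_sumZr.
  apply: memv_suml => j _; apply: memvZ.
  apply: (subvP sW); apply: memv_span; apply: allpairs_f.
    by apply: mem_nth; rewrite size_tuple.
  by apply: mem_nth; rewrite size_tuple.
by apply/span_subvP => _ /allpairsP [[u v] /= [uU vV ->]]; apply: H;
   apply: vbasis_mem.
Qed.

Definition lie_subalgebra U : bool := (lie_prod U U <= U)%VS.

Definition lie_ideal I : bool := (lie_prod fullv I <= I)%VS.

Definition lie_abelian U : bool := lie_prod U U == 0%VS.

Definition maximal_subalgebra M : Prop :=
  [/\ lie_subalgebra M, M <> fullv &
      forall K : {vspace L}, lie_subalgebra K -> K <> fullv ->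
        (M <= K)%VS -> K = M].

Definition supplement M U : Prop :=
  lie_subalgebra U /\ (M + U = fullv)%VS.

Definition ad_nilpotent x : Prop :=
  exists n : nat, forall y, iter n (lie_bracket x) y = 0.

Definition derived_series (n : nat) : {vspace L} :=
  iter n (fun U => lie_prod U U) fullv.

(* Lower central series of the subalgebra U, starting at index 0 with U. *)
Definition lower_central_series U (n : nat) : {vspace L} :=
  iter n (lie_prod U) U.

Definition lie_nilpotent U : Prop :=
  exists n : nat, lower_central_series U n = 0%VS.

Definition is_frattini_ideal I : Prop :=
  [/\ lie_ideal I, (forall M, maximal_subalgebra M -> (I <= M)%VS) &
      forall J, lie_ideal J -> (forall M, maximal_subalgebra M -> (J <= M)%VS) ->
        (J <= I)%VS].

Lemma frattini_ideal_exists : exists I, is_frattini_ideal I.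
Proof.
pose P I := lie_ideal I /\ forall M, maximal_subalgebra M -> (I <= M)%VS.
have P0 : P 0%VS.
  split=> [|M _]; last exact: sub0v.
  apply/lie_prodP => x y _; rewrite memv0 => /eqP ->.
  by have := lie_sumZr [::] (fun=> 0) (fun _ : L => 0) x;
    rewrite !big_nil => ->; rewrite mem0v.
have PD I J : P I -> P J -> P (I + J)%VS.
  move=> [/lie_prodP idI sI] [/lie_prodP idJ sJ]; split=> [|M maxM]; last first.
    by rewrite subv_add sI ?sJ.
  apply/lie_prodP => x _ xL /memv_addP[i iI [j jJ ->]].
  by rewrite -[i]scale1r lie_linear_r scale1r memv_add ?idI ?idJ.
pose Q n := `[<exists2 I, P I & \dim I = n>].
have exQ : exists n, Q n by exists (\dim (0%VS : {vspace L})); apply/asboolP; exists 0%VS.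
have ubQ n : Q n -> (n <= \dim {: L})%N.
  by move=> /asboolP[I _ <-]; apply/dimvS/subvf.
case: (ex_maxnP exQ ubQ) => n /asboolP[I PI dimI] maxn.
exists I; case: (PI) => idI sI; split=> // J idJ sJ.
have PIJ : P (I + J)%VS by apply: PD.
have le : (\dim (I + J) <= \dim I)%N.
  by rewrite dimI; apply: maxn; apply/asboolP; exists (I + J)%VS.
have /eqP -> : I == (I + J)%VS by rewrite eqEdim addvSl le.
exact: addvSr.
Qed.

End LieTheory.

Section LieClasses.
Variables (F : fieldType) (L : lieAlgType F).

Definition lie_square : {vspace L} := lie_prod fullv fullv.

Definition frattini_ideal : {vspace L} := sval (cid (frattini_ideal_exists L)).

Lemma frattini_idealP : is_frattini_ideal frattini_ideal.
Proof. exact: (svalP (cid (frattini_ideal_exists L))). Qed.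

Definition phi_free : Prop := frattini_ideal = 0%VS.

Definition solvable_lie : Prop := exists n : nat, derived_series L n = 0%VS.

Definition nilpotent_lie : Prop := lie_nilpotent ({:L}%VS : {vspace L}).

Definition completely_solvable_lie : Prop := lie_nilpotent lie_square.

Definition supersolvable_lie : Prop :=
  exists (n : nat) (C : 'I_n.+1 -> {vspace L}),
    [/\ C ord0 = 0%VS, C ord_max = fullv,
        (forall i j : 'I_n.+1, (i <= j)%N -> (C i <= C j)%VS) &
        forall i : 'I_n.+1, lie_ideal (C i) /\ \dim (C i) = i].

Definition metabelian_lie : Prop := lie_prod lie_square lie_square = 0%VS.

Definition class_MA : Prop :=
  forall M : {vspace L}, maximal_subalgebra M ->
    exists2 U : {vspace L}, supplement M U & lie_abelian U.

Definition class_MD : Prop :=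
  forall M : {vspace L}, maximal_subalgebra M ->
    exists2 U : {vspace L}, supplement M U & (lie_prod U U <= M)%VS.

Definition class_MU : Prop :=
  forall M : {vspace L}, maximal_subalgebra M ->
    exists2 U : {vspace L}, supplement M U & forall u, u \in U -> ad_nilpotent u.

End LieClasses.

(* Main.v *)
Require Import Defs.
From HB Require Import structures.
From mathcomp Require Import all_boot all_order all_algebra.
From mathcomp Require Import boolp.

Set Implicit Arguments.
Unset Strict Implicit.
Unset Printing Implicit Defensive.

Import GRing.Theory.
Local Open Scope ring_scope.

(** Let M be a maximal subalgebra.  An ideal I that M does not contain is a
    supplement of M, since M + I is a subalgebra strictly above M.  Along any
    series of ideals ending at 0 there is a last term I outside M, and the next
    term lies in M.  This observation gives everything except (ii).

    - For the derived series the next term is [I, I]: this is (i).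
    - For a chain with one-dimensional factors, any x in I outside M already
      satisfies M + <x> = L, and a line is abelian: this is (iii).
    - For L >= L^2 >= 0 with L^2 abelian, either I = L^2, or L^2 <= M and
      any line outside M is a supplement: this is (iv).
    - For the lower central series of a nilpotent ideal N, with last term
      I = N_k outside M, the modular law gives N = (M :&: N) + N_k, so
      [N, N] <= [M, M] + [N, N_k] <= M.  Hence [N, N] lies in the Frattini
      ideal, and with N = L^2 a completely solvable phi-free algebra is
      metabelian.

    In (ii) a nilpotent algebra is itself the supplement.  Conversely, if L is
    not nilpotent its lower central series stabilises at a nonzero ideal
    D = [L, D]; let D / B be a chief factor at the top of D, and C the set of
    elements that act trivially on it.  A nilpotent ideal of L acts trivially
    on every chief factor, so C contains L^2.  Therefore all elements of L
    commute in their action on D / B, the image of a single ad x is then a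
    submodule, and irreducibility forces an ad-nilpotent x into C.  As
    [L, D] = D, C is proper, and a hyperplane M containing C is a maximal
    subalgebra because it contains L^2.  A supplement of M by ad-nilpotent elements
    would lie in C, hence in M: a contradiction. *)

Section LieSupplements.
Variables (F : fieldType) (L : lieAlgType F).
Implicit Types (x y : L) (U V W M I J A B C D N : {vspace L}).

(** * Brackets of elements and of subspaces *)

HB.instance Definition _ x :=
  GRing.isLinear.Build F L L *:%R (lie_bracket x) (lie_linear_r x).

Lemma lie_bracketDl y : {morph (lie_bracket (s := L))^~ y : x z / x + z}.
Proof. by move=> x z; rewrite -[x]scale1r lie_linear_l !scale1r. Qed.

Lemma lie_bracketC x y : lie_bracket x y = - lie_bracket y x.
Proof.
have := lie_alternating (x + y).
by rewrite lie_bracketDl !linearD /= !lie_alternating add0r addr0 => /eqP;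
  rewrite addr_eq0 => /eqP.
Qed.

Lemma lie_bracketZl a x y : lie_bracket (a *: x) y = a *: lie_bracket x y.
Proof. by rewrite lie_bracketC linearZ /= -scalerN -lie_bracketC. Qed.

Lemma lie_leibniz x y z :
  lie_bracket x (lie_bracket y z) =
    lie_bracket (lie_bracket x y) z + lie_bracket y (lie_bracket x z).
Proof.
have /eqP := lie_jacobi x y z.
rewrite -addrA addr_eq0 => /eqP ->.
rewrite (lie_bracketC z x) (lie_bracketC z (lie_bracket x y)) linearN /=.
by rewrite -opprD opprK addrC.
Qed.

Lemma mem_lie_prod U V x y :
  x \in U -> y \in V -> lie_bracket x y \in lie_prod U V.
Proof. by move: x y; apply/lie_prodP. Qed.

Lemma lie_prodS U U' V V' :
  (U <= U')%VS -> (V <= V')%VS -> (lie_prod U V <= lie_prod U' V')%VS.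
Proof.
move=> sU sV; apply/lie_prodP => x y xU yV.
by rewrite mem_lie_prod ?(subvP sU) ?(subvP sV).
Qed.

Lemma lie_prodv0 U : lie_prod U 0%VS = 0%VS.
Proof.
apply/eqP; rewrite -subv0; apply/lie_prodP => x y _.
by rewrite !memv0 => /eqP ->; rewrite linear0.
Qed.

Lemma lie_ideal_bracketr I x y :
  lie_ideal I -> y \in I -> lie_bracket x y \in I.
Proof. by move/lie_prodP => idI; apply: idI; rewrite memvf. Qed.

Lemma lie_ideal_bracketl I x y :
  lie_ideal I -> x \in I -> lie_bracket x y \in I.
Proof. by move=> idI xI; rewrite lie_bracketC memvN lie_ideal_bracketr. Qed.

Lemma lie_ideal_prodr I U : lie_ideal I -> (lie_prod U I <= I)%VS.
Proof. by move=> idI; apply/lie_prodP => x y _; apply: lie_ideal_bracketr. Qed.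

Lemma lie_ideal_prodl I U : lie_ideal I -> (lie_prod I U <= I)%VS.
Proof. by move=> idI; apply/lie_prodP => x y xI _; apply: lie_ideal_bracketl. Qed.

Lemma lie_ideal_subalgebra I : lie_ideal I -> lie_subalgebra I.
Proof. exact: lie_ideal_prodr. Qed.

Lemma lie_ideal_fullv : lie_ideal (fullv : {vspace L}).
Proof. exact: subvf. Qed.

Lemma lie_ideal0 : lie_ideal (0%VS : {vspace L}).
Proof. by rewrite /lie_ideal lie_prodv0. Qed.

Lemma lie_idealD I J : lie_ideal I -> lie_ideal J -> lie_ideal (I + J)%VS.
Proof.
move=> idI idJ; apply/lie_prodP => x _ _ /memv_addP[i iI [j jJ ->]].
by rewrite linearD memv_add ?lie_ideal_bracketr.
Qed.

(** Each x acts on L as a derivation, so the z with [x, z] in [I, J] form a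
    subspace containing all brackets of I with J. *)
Lemma lie_ideal_prod I J : lie_ideal I -> lie_ideal J -> lie_ideal (lie_prod I J).
Proof.
move=> idI idJ; apply/lie_prodP => x z _ zIJ.
have: (lie_prod I J <= linfun (lie_bracket x) @^-1: lie_prod I J)%VS.
  apply/lie_prodP => i j iI jJ; rewrite -memv_preim lfunE /= lie_leibniz.
  by rewrite memvD ?mem_lie_prod ?lie_ideal_bracketr.
by move/subvP/(_ z zIJ); rewrite -memv_preim lfunE.
Qed.

Lemma lie_ideal_square : lie_ideal (lie_square L).
Proof. by apply: lie_ideal_prod; apply: lie_ideal_fullv. Qed.

Lemma lie_ideal_derived n : lie_ideal (derived_series L n).
Proof.
elim: n => [|n IHn]; first exact: lie_ideal_fullv.
exact: lie_ideal_prod.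
Qed.

Lemma lie_ideal_lower_central N n :
  lie_ideal N -> lie_ideal (lower_central_series N n).
Proof. by move=> idN; elim: n => // n IHn; apply: lie_ideal_prod. Qed.

(** * Supplements of a maximal subalgebra *)

Lemma lie_abelian_line x : lie_abelian <[x]>%VS.
Proof.
rewrite /lie_abelian -subv0; apply/lie_prodP => _ _ /vlineP[a ->] /vlineP[b ->].
by rewrite linearZ /= lie_bracketZl lie_alternating !scaler0 mem0v.
Qed.

Lemma lie_abelian_subalgebra U : lie_abelian U -> lie_subalgebra U.
Proof. by move=> /eqP abU; rewrite /lie_subalgebra abU sub0v. Qed.

Lemma maximal_subalgebra_not_full M :
  maximal_subalgebra M -> ~~ (fullv <= M)%VS.
Proof. by case=> _ /eqP Mn _; apply: contra Mn; rewrite eqEsubv subvf. Qed.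

Lemma maximal_add_full M V :
  maximal_subalgebra M -> lie_subalgebra (M + V)%VS -> ~~ (V <= M)%VS ->
  (M + V)%VS = fullv.
Proof.
move=> [_ _ maxM] sMV; apply: contraNeq => /eqP nfull.
by rewrite -[X in (_ <= X)%VS](maxM _ sMV nfull (addvSl _ _)) addvSr.
Qed.

Lemma ideal_add_full M I :
  maximal_subalgebra M -> lie_ideal I -> ~~ (I <= M)%VS -> (M + I)%VS = fullv.
Proof.
move=> maxM idI; apply: maximal_add_full => //.
case: maxM => /lie_prodP sM _ _.
apply/lie_prodP => _ _ /memv_addP[m mM [i iI ->]] /memv_addP[m' m'M [i' i'I ->]].
rewrite lie_bracketDl linearD /= -addrA memv_add ?sM //.
by apply: memvD; [apply: lie_ideal_bracketr | apply: lie_ideal_bracketl].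
Qed.

Lemma ideal_supplement M I :
  maximal_subalgebra M -> lie_ideal I -> ~~ (I <= M)%VS -> supplement M I.
Proof.
by move=> *; split; [apply: lie_ideal_subalgebra | apply: ideal_add_full].
Qed.

Lemma line_supplement M x : (M + <[x]>)%VS = fullv -> supplement M <[x]>.
Proof. by split=> //; apply/lie_abelian_subalgebra/lie_abelian_line. Qed.

Lemma exists_switch (P : pred nat) n :
  P 0%N -> ~~ P n -> exists k, [/\ (k < n)%N, P k & ~~ P k.+1].
Proof.
move=> P0; elim: n => [|n IHn] nPn; first by rewrite P0 in nPn.
have [Pn|/IHn[k [ltkn Pk nPk]]] := boolP (P n); first by exists n.
by exists k; split=> //; apply: ltnW.
Qed.

Lemma last_term_outside (S : nat -> {vspace L}) M n :
  ~~ (S 0%N <= M)%VS -> (S n <= M)%VS ->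
  exists2 k, ~~ (S k <= M)%VS & (S k.+1 <= M)%VS.
Proof.
move=> S0 Sn; have [|k [_ Sk /negPn Sk1]] :=
  @exists_switch (fun k => ~~ (S k <= M)%VS) n S0; first by rewrite negbK.
by exists k.
Qed.

Lemma solvable_class_MD : solvable_lie L -> class_MD L.
Proof.
move=> [n Ln0] M maxM.
have [||k nLk Lk1] := @last_term_outside (derived_series L) M n.
- exact: maximal_subalgebra_not_full.
- by rewrite Ln0 sub0v.
exists (derived_series L k) => //.
by apply: ideal_supplement => //; apply: lie_ideal_derived.
Qed.

(** At the first term of the chain outside M, any vector x of that term not in
    M spans it modulo the previous term, so the line <[x]> does the work of the
    whole ideal. *)
Lemma supersolvable_class_MA : supersolvable_lie L -> class_MA L.
Proof.
move=> [n [C [C0 Cn homoC idC]]] M maxM.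
have ord_n : inord n = ord_max :> 'I_n.+1 by apply/val_inj; rewrite /= inordK.
have ord_0 : inord 0 = ord0 :> 'I_n.+1 by apply/val_inj; rewrite /= inordK.
have [||k [ltkn CkM nCk1]] := @exists_switch (fun i => C (inord i) <= M)%VS n.
- by rewrite ord_0 C0 sub0v.
- by rewrite ord_n Cn maximal_subalgebra_not_full.
have [idCk1 dimCk1] := idC (inord k.+1); have [_ dimCk] := idC (inord k).
rewrite inordK ?ltnS // in dimCk1; rewrite inordK 1?ltnW // in dimCk.
have sCC : (C (inord k) <= C (inord k.+1))%VS.
  by apply: homoC; rewrite !inordK ?ltnS // ltnW.
have /subvPn[x xC xM] := nCk1.
exists <[x]>%VS; last exact: lie_abelian_line.
apply: line_supplement.
have defC : (C (inord k) + <[x]>)%VS = C (inord k.+1).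
  have sCk := addvSl (C (inord k)) <[x]>.
  have ltC : (\dim (C (inord k)) < \dim (C (inord k) + <[x]>))%N.
    rewrite ltnNge (geq_leqif (dimv_leqif_sup sCk)) subv_add subvv -memvE.
    by apply: contra xM => /(subvP CkM).
  rewrite dimCk in ltC.
  by apply/eqP; rewrite eqEdim subv_add sCC -memvE xC dimCk1.
apply/eqP; rewrite eqEsubv subvf -(ideal_add_full maxM idCk1 nCk1) -defC addvA.
by rewrite (addv_idPl CkM) subvv.
Qed.

(** If M contains L^2, every subspace above M is a subalgebra, so any line
    outside M is a supplement. *)
Lemma metabelian_class_MA : metabelian_lie L -> class_MA L.
Proof.
move=> abL2 M maxM; have [sL2M|nL2M] := boolP (lie_square L <= M)%VS; last first.
  exists (lie_square L); last by apply/eqP.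
  by apply: ideal_supplement => //; apply: lie_ideal_square.
have /subvPn[x _ xM] := maximal_subalgebra_not_full maxM.
exists <[x]>%VS; last exact: lie_abelian_line.
apply/line_supplement/maximal_add_full => //.
apply: subv_trans (addvSl M _); apply: subv_trans sL2M.
by apply: lie_prodS; apply: subvf.
Qed.

(** * The square of a nilpotent ideal lies in the Frattini ideal *)

(** With N_k the last term outside M, the modular law writes N as
    (M :&: N) + N_k.  Brackets within M :&: N stay in M, and all the others
    fall in [N, N_k], the next term. *)
Lemma nilpotent_ideal_square_maximal N M :
  lie_ideal N -> lie_nilpotent N -> maximal_subalgebra M ->
  (lie_prod N N <= M)%VS.
Proof.
move=> idN [n Nn0] maxM; have [sNM|nNM] := boolP (N <= M)%VS.
  exact: subv_trans (lie_ideal_prodr _ idN) sNM.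
have [//||k nNkM Nk1M] := @last_term_outside (lower_central_series N) M n.
  by rewrite Nn0 sub0v.
have idNk := lie_ideal_lower_central k idN.
have sNkN : (lower_central_series N k <= N)%VS.
  by case: (k) => [|j] //=; apply/lie_ideal_prodl.
have MNk := ideal_add_full maxM idNk nNkM.
have defN : (N <= (M :&: N) + lower_central_series N k)%VS.
  by rewrite capvC vspace_modr // MNk capvf.
have sNNk x y :
    x \in N -> y \in lower_central_series N k -> lie_bracket x y \in M.
  by move=> xN yNk; apply: (subvP Nk1M); apply: mem_lie_prod.
apply/lie_prodP => x y xN yN.
have /memv_addP[m /memv_capP[mM mN] [z zNk ->]] := subvP defN x xN.
have /memv_addP[m' /memv_capP[m'M m'N] [z' z'Nk ->]] := subvP defN y yN.
case: maxM => /lie_prodP sM _ _.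
rewrite lie_bracketDl linearD /= -addrA memvD ?sM //.
apply: memvD; first exact: sNNk.
by rewrite lie_bracketC memvN sNNk // memvD // (subvP sNkN).
Qed.

Lemma nilpotent_ideal_square_frattini N :
  lie_ideal N -> lie_nilpotent N -> (lie_prod N N <= frattini_ideal L)%VS.
Proof.
move=> idN nilN; have [_ _ maxphi] := frattini_idealP L.
apply: maxphi => [|M maxM]; first exact: lie_ideal_prod.
exact: nilpotent_ideal_square_maximal.
Qed.

Lemma phi_free_metabelian :
  completely_solvable_lie L -> phi_free L -> metabelian_lie L.
Proof.
move=> nilL2 phi0; apply/eqP; rewrite -subv0 -phi0.
by apply: nilpotent_ideal_square_frattini => //; apply: lie_ideal_square.
Qed.

(** * Chief factors *)

Lemma exists_max_subspace (P : {vspace L} -> Prop) U :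
  P U -> exists2 V, P V & forall W, P W -> (\dim W <= \dim V)%N.
Proof.
move=> PU; pose Q n := `[<exists2 V, P V & \dim V = n>].
have exQ : exists n, Q n by exists (\dim U); apply/asboolP; exists U.
have ubQ n : Q n -> (n <= \dim {: L})%N.
  by move=> /asboolP[V _ <-]; apply/dimvS/subvf.
have [n /asboolP[V PV dimV] maxn] := ex_maxnP exQ ubQ.
by exists V => // W PW; rewrite dimV; apply: maxn; apply/asboolP; exists W.
Qed.

Definition chief_factor A B :=
  [/\ lie_ideal B, (B <= A)%VS, ~~ (A <= B)%VS &
      forall J, lie_ideal J -> (B <= J)%VS -> (J <= A)%VS -> ~~ (A <= J)%VS ->
        (J <= B)%VS].

Lemma chief_factor_exists A : A <> 0%VS -> exists B, chief_factor A B.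
Proof.
move=> An0.
have [|B [idB sBA nAB] maxB] := @exists_max_subspace
    (fun B => [/\ lie_ideal B, (B <= A)%VS & ~~ (A <= B)%VS]) 0%VS.
  by split; rewrite ?sub0v ?subv0 ?lie_ideal0 //; apply/eqP.
exists B; split=> // J idJ sBJ sJA nAJ.
suff /eqP <- : B == J by [].
by rewrite eqEdim sBJ maxB.
Qed.

(** The submodule [N, A] + B is B or A; were it A, iterating would put A in
    N_n + B for every n, hence in B. *)
Lemma nilpotent_ideal_chief N A B :
  lie_ideal N -> lie_nilpotent N -> lie_ideal A -> chief_factor A B ->
  (lie_prod N A <= B)%VS.
Proof.
move=> idN [n Nn0] idA [idB sBA nAB irr].
suff /irr sB : ~~ (A <= lie_prod N A + B)%VS.
  apply: subv_trans (addvSl _ B) (sB _ _ _); rewrite ?addvSr //.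
    by rewrite lie_idealD ?lie_ideal_prod.
  by rewrite subv_add sBA lie_ideal_prodr.
apply: contra nAB => sA.
suff sAN k : (A <= lower_central_series N k + B)%VS.
  by have := sAN n; rewrite Nn0 add0v.
elim: k => [|k IHk]; apply: subv_trans sA _.
  by rewrite addvS ?lie_ideal_prodl.
rewrite subv_add addvSr andbT.
apply/lie_prodP => x a xN /(subvP IHk)/memv_addP[z zNk [b bB ->]].
rewrite linearD; apply: memv_add; first exact: mem_lie_prod.
exact: lie_ideal_bracketr.
Qed.

Lemma iter_lie_bracketD x n :
  {morph iter n (lie_bracket x) : y z / y + z}.
Proof. by move=> y z; elim: n => //= n ->; rewrite linearD. Qed.

(** As L^2 kills A / B, the action of x on A / B commutes with that of L, so
    its image is a submodule; it is not all of A / B because x is nilpotent. *)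
Lemma ad_nilpotent_chief A B x :
  lie_ideal A -> chief_factor A B -> (lie_prod (lie_square L) A <= B)%VS ->
  ad_nilpotent x -> (lie_prod <[x]> A <= B)%VS.
Proof.
move=> idA [idB sBA nAB irr] /lie_prodP L2A [n xn0].
pose adA := (linfun (lie_bracket x) @: A)%VS.
have adAP a : a \in A -> lie_bracket x a \in adA.
  by move=> aA; have := memv_img (linfun (lie_bracket x)) aA; rewrite lfunE.
have sadAA : (adA <= A)%VS.
  by apply/subvP => _ /memv_imgP[a aA ->]; rewrite lfunE lie_ideal_bracketr.
have idJ : lie_ideal (adA + B)%VS.
  apply/lie_prodP => y _ _ /memv_addP[_ /memv_imgP[a aA ->] [b bB ->]].
  rewrite lfunE linearD /= lie_leibniz -addrA addrCA memv_add //.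
    by rewrite adAP ?lie_ideal_bracketr.
  apply: memvD; last exact: lie_ideal_bracketr.
  by rewrite L2A // mem_lie_prod ?memvf.
suff /(irr _ idJ (addvSr _ _)) sJB : ~~ (A <= adA + B)%VS.
  apply/lie_prodP => _ a /vlineP[c ->] aA; rewrite lie_bracketZl memvZ //.
  apply: (subvP (sJB _)); first by rewrite subv_add sadAA.
  by rewrite (subvP (addvSl _ _)) ?adAP.
apply: contra nAB => /subvP sA; apply/subvP => a aA.
suff [c _ [b bB ->]] : exists2 c, c \in A &
    exists2 b, b \in B & a = iter n (lie_bracket x) c + b.
  by rewrite xn0 add0r.
elim: n {xn0} => [|n [c cA [b bB ->]]].
  by exists a => //; exists 0; rewrite ?mem0v ?addr0.
have /memv_addP[_ /memv_imgP[c' c'A ->] [b' b'B ->]] := sA c cA.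
exists c' => //; exists (iter n (lie_bracket x) b' + b).
  by rewrite memvD //; elim: (n) => //= m; apply: lie_ideal_bracketr.
by rewrite lfunE iter_lie_bracketD iterSr addrA.
Qed.

(** * Completely solvable algebras in MU *)

(** The x with [x, A] <= B are closed under sums, so a subspace of largest
    dimension among those that send A into B absorbs every such x. *)
Lemma transporter_exists A B :
  exists C, forall x, (x \in C) = (lie_prod <[x]> A <= B)%VS.
Proof.
have [|C CAB maxC] :=
    @exists_max_subspace (fun V => (lie_prod V A <= B)%VS) 0%VS.
  apply/lie_prodP => x a; rewrite memv0 => /eqP -> _.
  by rewrite lie_bracketC linear0 oppr0 mem0v.
exists C => x; apply/idP/idP => [xC | /lie_prodP xAB].
  by apply: subv_trans CAB; rewrite lie_prodS.
have: (\dim (C + <[x]>) <= \dim C)%N.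
  apply: maxC; apply/lie_prodP => _ a /memv_addP[c cC [z zx ->]] aA.
  rewrite lie_bracketDl; apply: memvD; last exact: xAB.
  by move/lie_prodP: CAB; apply.
rewrite (geq_leqif (dimv_leqif_sup (addvSl _ _))) => /subvP; apply.
by rewrite (subvP (addvSr _ _)) ?memv_line.
Qed.

(** Every subspace containing L^2 is a subalgebra, so a largest proper subspace
    above C is also a maximal subalgebra. *)
Lemma maximal_subalgebra_above C :
  (lie_square L <= C)%VS -> C <> fullv ->
  exists2 M, maximal_subalgebra M & (C <= M)%VS.
Proof.
move=> sL2C nC.
have [|M [sCM nM] maxM] := @exists_max_subspace
    (fun V => (C <= V)%VS /\ V <> fullv) C; first by [].
exists M => //; split=> // [|K _ nK sMK].
  apply: subv_trans (subv_trans sL2C sCM).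
  by apply: lie_prodS; apply: subvf.
apply/eqP; rewrite eq_sym eqEdim sMK maxM //; split=> //.
exact: subv_trans sMK.
Qed.

(** The series decreases, so it is stationary from a term of least dimension. *)
Lemma lower_central_stable :
  exists n, lie_prod fullv (lower_central_series fullv n) =
            lower_central_series (fullv : {vspace L}) n.
Proof.
have ex0 : exists m, `[<exists n,
    \dim (lower_central_series (fullv : {vspace L}) n) = m>].
  by exists (\dim {:L}); apply/asboolP; exists 0%N.
case: (ex_minnP ex0) => m /asboolP[n dimn] minm; exists n.
have idn := lie_ideal_lower_central n lie_ideal_fullv.
apply/eqP; rewrite eqEdim dimn; apply/andP; split; first exact: idn.
by apply: minm; apply/asboolP; exists n.+1.
Qed.

(** In a chief factor D / B of D = [L, D], the elements that act trivially form
    a proper subspace C containing L^2 and all ad-nilpotent elements; a maximal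
    subalgebra above C then contains every subalgebra of ad-nilpotent elements,
    so it has no supplement of that kind. *)
Lemma completely_solvable_MU_nilpotent :
  completely_solvable_lie L -> class_MU L -> nilpotent_lie L.
Proof.
move=> nilL2 MU; have [n stab] := lower_central_stable; exists n.
set D := lower_central_series _ n in stab *; apply/eqP/negPn/negP => /eqP Dn0.
have idD : lie_ideal D by apply/lie_ideal_lower_central/lie_ideal_fullv.
have [B chDB] := chief_factor_exists Dn0.
have [C CP] := transporter_exists D B.
have L2DB := nilpotent_ideal_chief lie_ideal_square nilL2 idD chDB.
have [||M maxM sCM] := @maximal_subalgebra_above C.
- apply/subvP => x xL2; rewrite CP.
  by apply: subv_trans L2DB; rewrite lie_prodS.
- move=> Cfull; case: chDB => _ _ /negP[]; rewrite -stab.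
  apply/lie_prodP => x d _ dD.
  have: x \in C by rewrite Cfull memvf.
  by rewrite CP => /lie_prodP; apply; rewrite ?memv_line.
have [U [_ MU1] nilU] := MU M maxM.
have /negP[] := maximal_subalgebra_not_full maxM.
rewrite -MU1 subv_add subvv; apply/subvP => u uU; apply: (subvP sCM).
by rewrite CP; apply: ad_nilpotent_chief => //; apply: nilU.
Qed.

Lemma nilpotent_class_MU : nilpotent_lie L -> class_MU L.
Proof.
move=> [n Ln0] M maxM; exists fullv => [|u _].
  apply: ideal_supplement => //; first exact: lie_ideal_fullv.
  exact: maximal_subalgebra_not_full.
exists n => y; apply/eqP; rewrite -memv0 -Ln0.
by elim: n {Ln0} => [|n IHn]; rewrite ?memvf //= mem_lie_prod ?memvf.
Qed.

End LieSupplements.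

Theorem proposition2p3 (F : fieldType) (L : lieAlgType F) :
  [/\ (solvable_lie L -> class_MD L),
      (completely_solvable_lie L -> (class_MU L <-> nilpotent_lie L)),
      (supersolvable_lie L -> class_MA L) &
      (metabelian_lie L -> class_MA L) /\
      (completely_solvable_lie L -> phi_free L -> class_MA L)].
Proof.
split.
- exact: solvable_class_MD.
- move=> csL; split; first exact: completely_solvable_MU_nilpotent.
  exact: nilpotent_class_MU.
- exact: supersolvable_class_MA.
- split=> [|csL phiL]; first exact: metabelian_class_MA.
  exact/metabelian_class_MA/phi_free_metabelian.
Qed.
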